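(* Let $G$ be a nonsolvable finite group with $G=H\times K$. (1) If $K$ is a solvable group, then $\alpha(G)=\alpha(H)$. (2) If $H$ and $K$ are nonsolvable groups, then $\alpha(G)=\min\{\alpha(H),\alpha(K)\}$.
   Context: All groups are finite. $R(G)$ denotes the solvable radical of $G$ (the largest solvable normal subgroup). For $x\in G$, the solvabilizer of $x$ is $\mathrm{Sol}_G(x)=\{y\in G\mid \langle x,y\rangle \text{ is solvable}\}$. For nonsolvable $G$, a solvabilizer covering of $G$ is a set $X\subset G\setminus R(G)$ such that $G=\bigcup_{x\in X}\mathrm{Sol}_G(x)$, and the solvabilizer number $\alpha(G)$ is the minimum cardinality of a solvabilizer covering of $G$. *)

(* Defs.v *)
From HB Require Import structures.
From mathcomp Require Import all_boot all_fingroup all_solvable.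

Set Implicit Arguments.
Unset Strict Implicit.
Unset Printing Implicit Defensive.

Local Open Scope group_scope.

Section Solvabilizer.

Variable gT : finGroupType.
Implicit Types (G N : {group gT}) (X : {set gT}) (x : gT).

(* "Largest" is by order here; solv_radicalP shows that it is also the largest
   for inclusion, so the choice made by arg max is unique. *)
Definition solv_radical G : {group gT} :=
  [arg max_(N > 1%G | (N <| G) && solvable N) #|N|]%N.

Definition solvabilizer G x : {set gT} :=
  [set y in G | solvable <<[set x; y]>>].

Definition solv_covering G X : bool :=
  (X \subset G :\: solv_radical G) &&
  (G :==: \bigcup_(x in X) solvabilizer G x).

(* The default G :\: solv_radical G is itself a covering when G is
   nonsolvable (solv_coveringD), so alpha G is then the minimum. For solvable G
   there is no covering and the value 0 carries no meaning. *)
Definition alpha G : nat :=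
  #|[arg min_(X < G :\: solv_radical G | solv_covering G X) #|X|]|%N.

Lemma solv_radicalP G :
  [/\ solv_radical G <| G, solvable (solv_radical G) &
      forall N, N <| G -> solvable N -> N \subset solv_radical G].
Proof.
rewrite /solv_radical; case: arg_maxnP; first by rewrite normal1 solvable1.
move=> R /andP[nRG solR] maxR; split=> // N nNG solN.
have nJG : R <*> N <| G by rewrite normalY.
have nNR : N \subset 'N(R).
  exact: subset_trans (normal_sub nNG) (normal_norm nRG).
have solJ : solvable (R <*> N).
  have nRJ : R <| R <*> N by rewrite normalYl.
  by rewrite (series_sol nRJ) solR quotientYidl // quotient_sol.
have leJ : #|R <*> N| <= #|R| by apply: (maxR (R <*> N)%G); rewrite nJG.
have /eqP-> : R :==: R <*> N by rewrite eqEcard joing_subl.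
exact: joing_subr.
Qed.

Lemma solv_coveringD G :
  ~~ solvable G -> solv_covering G (G :\: solv_radical G).
Proof.
have [nRG solR _] := solv_radicalP G; move=> nsolG.
have [x Gx nRx] : exists2 x, x \in G & x \notin solv_radical G.
  by apply/subsetPn; apply: contra nsolG => sGR; apply: solvableS solR.
rewrite /solv_covering subxx /= eqEsubset; apply/andP; split; last first.
  by apply/bigcupsP=> z _; apply/subsetP=> y; rewrite inE => /andP[].
apply/subsetP=> y Gy; case: (boolP (y \in solv_radical G)) => Ry.
  apply/bigcupP; exists x; rewrite !inE ?nRx //= Gy /=.
  have nRx' : <[x]> \subset 'N(solv_radical G).
    by rewrite cycle_subG (subsetP (normal_norm nRG)).
  have solJ : solvable (solv_radical G <*> <[x]>).
    have nRJ : solv_radical G <| solv_radical G <*> <[x]> by rewrite normalYl.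
    rewrite (series_sol nRJ) solR quotientYidl // quotient_sol //.
    exact: abelian_sol (cycle_abelian x).
  apply: solvableS solJ; rewrite gen_subG subUset !sub1set.
  rewrite (subsetP (joing_subr _ _)) ?cycle_id //.
  by rewrite (subsetP (joing_subl _ _)).
apply/bigcupP; exists y; rewrite !inE ?Ry //= Gy /= setUid.
exact: abelian_sol (cycle_abelian y).
Qed.

Lemma alphaP G (nsolG : ~~ solvable G) :
  (exists2 X, solv_covering G X & #|X| = alpha G) /\
  (forall X, solv_covering G X -> alpha G <= #|X|).
Proof.
rewrite /alpha; case: arg_minnP; first exact: solv_coveringD.
by move=> X covX minX; split; first by exists X.
Qed.

End Solvabilizer.

(* Main.v *)
Require Import Defs.
From mathcomp Require Import all_boot all_fingroup all_solvable.

(** In [G = H \x K], the subgroup generated by [a * b] and [c * d] (with [a], [c]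
in [H] and [b], [d] in [K]) is solvable iff both [<a, c>] and [<b, d>] are. Hence
a covering of a factor is a covering of [G]. Conversely, given a covering [X] of
[G], suppose [h] escapes the projection of [X] to [H] (radical elements removed)
and [k] escapes the one to [K]. Some [x] in [X] covers [h * k]; its two components
cover [h] and [k], so both lie in the radicals of the factors and [x] lies in the
radical of [G], a contradiction. So one of the two projections is a covering. *)

Set Implicit Arguments.
Unset Strict Implicit.
Unset Printing Implicit Defensive.

Local Open Scope group_scope.

Section Coverings.

Variable gT : finGroupType.
Implicit Types (G H K : {group gT}) (X : {set gT}).

Lemma solv_coveringP G X :
  reflect (X \subset G :\: solv_radical G /\
           {in G, forall y, exists2 x, x \in X & solvable <<[set x; y]>>})
          (solv_covering G X).
Proof.
apply: (iffP andP) => -[sXG covX]; split=> //.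
  move=> y; rewrite {1}(eqP covX) => /bigcupP[x Xx].
  by rewrite inE => /andP[_ solxy]; exists x.
rewrite eqEsubset; apply/andP; split; apply/subsetP=> y.
  move=> Gy; have [x Xx solxy] := covX y Gy.
  by apply/bigcupP; exists x; rewrite // inE Gy.
by case/bigcupP=> x _; rewrite inE => /andP[].
Qed.

(** A solvable [G] equals its radical, which would force [X] to be empty, yet some element of [X]
    has to cover [1]. *)
Lemma solv_covering_nsol G X : solv_covering G X -> ~~ solvable G.
Proof.
case/solv_coveringP=> sXG covX; apply/negP=> solG.
have [_ _ maxR] := solv_radicalP G.
have [x /(subsetP sXG)] := covX 1 (group1 G).
by rewrite inE => /andP[/negP nRx /(subsetP (maxR G (normal_refl G) solG))].
Qed.

Lemma solvable_cent_joing H K : K \subset 'C(H) ->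
  solvable (H <*> K) = solvable H && solvable K.
Proof.
move=> cHK; have nHK := subset_trans cHK (cent_sub H).
apply/idP/andP=> [solHK | [solH solK]].
  by rewrite !(solvableS _ solHK) ?joing_subl ?joing_subr.
have nHJ : H <| H <*> K by rewrite normalYl.
by rewrite (series_sol nHJ) solH quotientYidl // quotient_sol.
Qed.

(** Modulo [K] the factors [b] and [d] vanish, so both generated subgroups have the same image, and
    [<<[set a; c]>>] embeds in the quotient because [H] meets [K] trivially. *)
Lemma solvable_gen2_dprodl G H K a b c d : H \x K = G ->
  a \in H -> c \in H -> b \in K -> d \in K ->
  solvable <<[set a * b; c * d]>> -> solvable <<[set a; c]>>.
Proof.
case/dprodP=> _ _ cHK tiHK Ha Hc Kb Kd solabcd.
have nKH : H \subset 'N(K) by rewrite (subset_trans _ (cent_sub K)) // centsC.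
have sgenH : <<[set a; c]>> \subset H by rewrite gen_subG subUset !sub1set Ha.
have inNK z t : z \in H -> t \in K -> z * t \in 'N(K).
  by move=> Hz Kt; rewrite groupM ?(subsetP nKH z Hz) ?(subsetP (normG K) t Kt).
have coset_mulr z t : z \in H -> t \in K -> coset K (z * t) = coset K z.
  by move=> Hz Kt; rewrite mkerr ?(subsetP nKH) // ker_coset.
have tigen : K :&: <<[set a; c]>> = 1.
  by apply/trivgP; rewrite /= -tiHK setIC; apply: setSI.
(* Solvability can now be tested on the isomorphic image modulo [K]. *)
rewrite (isog_sol (quotient_isog (subset_trans sgenH nKH) tigen)).
have sub2 (x y : gT) : x \in 'N(K) -> y \in 'N(K) -> [set x; y] \subset 'N(K).
  by move=> Nx Ny; rewrite subUset !sub1set Nx.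
rewrite /=; have -> : <<[set a; c]>> / K = <<[set a * b; c * d]>> / K.
  rewrite !quotient_gen ?sub2 ?inNK ?(subsetP nKH) // !quotientU.
  by rewrite !quotient_set1 ?inNK ?(subsetP nKH) // !coset_mulr.
exact: quotient_sol.
Qed.

Lemma solvable_gen2_dprod G H K a b c d : H \x K = G ->
  a \in H -> c \in H -> b \in K -> d \in K ->
  solvable <<[set a * b; c * d]>> =
  solvable <<[set a; c]>> && solvable <<[set b; d]>>.
Proof.
move=> defG Ha Hc Kb Kd; have [_ _ cHK _] := dprodP defG.
apply/idP/andP=> [solabcd | [solac solbd]].
  split; first exact: (solvable_gen2_dprodl defG Ha Hc Kb Kd).
  apply: (@solvable_gen2_dprodl G K H b a d c) => //; first by rewrite dprodC.
  by rewrite -(centsP cHK b Kb a Ha) -(centsP cHK d Kd c Hc) in solabcd.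
(* For the converse, [a * b] and [c * d] lie in the join of two solvable subgroups that centralize
   each other. *)
have cgen : <<[set b; d]>> \subset 'C(<<[set a; c]>>).
  apply: (subset_trans _ (subset_trans cHK _)).
    by rewrite gen_subG subUset !sub1set Kb.
  by apply: centS; rewrite gen_subG subUset !sub1set Ha.
have solJ : solvable ([set a; c] <*> [set b; d]).
  by rewrite -joing_idl -joing_idr (solvable_cent_joing cgen) solac.
apply: solvableS solJ; rewrite gen_subG subUset !sub1set.
by rewrite !groupM // mem_gen // !inE eqxx ?orbT.
Qed.

(** The radical of one factor is centralized by the other factor, hence is normal in [G] and lies in
    its radical. *)
Lemma solv_radical_dprod_sub G H K : H \x K = G ->
  solv_radical H * solv_radical K \subset solv_radical G.
Proof.
case/dprodP=> _ defG cHK _.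
have [/andP[sRH nRH] solRH _] := solv_radicalP H.
have [/andP[sRK nRK] solRK _] := solv_radicalP K.
have [_ _ maxRG] := solv_radicalP G.
have normalG (R : {group gT}) : R \subset G -> H \subset 'N(R) -> K \subset 'N(R) -> R <| G.
  by move=> sRG nHR nKR; rewrite /normal sRG -defG mulG_subG nHR.
have sHG : H \subset G by rewrite -defG mulG_subl.
have sKG : K \subset G by rewrite -defG mulG_subr.
rewrite mulG_subG !maxRG // normalG //.
- exact: subset_trans sRK sKG.
- by apply: cents_norm; rewrite centsC (subset_trans sRK).
- exact: subset_trans sRH sHG.
- by apply: cents_norm; rewrite (subset_trans cHK) ?centS.
Qed.

(** The intersection is a solvable normal subgroup of [H]. This keeps a covering of a factor outside
    the radical of [G]. *)
Lemma solv_radical_setI_sub G H : H \subset G ->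
  solv_radical G :&: H \subset solv_radical H.
Proof.
move=> sHG; have [nRG solRG _] := solv_radicalP G.
have [_ _ maxRH] := solv_radicalP H.
apply: maxRH; first by rewrite /= setIC (normalGI sHG).
by apply: solvableS solRG; apply: subsetIl.
Qed.

Lemma solv_covering_dprodl G H K X : H \x K = G ->
  solv_covering H X -> solv_covering G X.
Proof.
move=> defG /solv_coveringP[sXH covX]; have [_ defHK _ _] := dprodP defG.
have sHG : H \subset G by rewrite -defHK mulG_subl.
apply/solv_coveringP; split=> [|y].
  apply/subsetP=> x /(subsetP sXH); rewrite !inE => /andP[nRx Hx].
  rewrite (subsetP sHG) // andbT; apply: contra nRx => Rx.
  by apply: (subsetP (solv_radical_setI_sub sHG)); rewrite inE Rx.
rewrite -defHK => /mulsgP[h k Hh Kk ->]; have [x Xx solxh] := covX h Hh.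
exists x => //; have := subsetP sXH x Xx; rewrite inE => /andP[_ Hx].
(* The [K]-component of [x] is [1], so in [K] only the cyclic group generated by [k] has to be
   solvable. *)
rewrite -[x]mulg1 (solvable_gen2_dprod defG) // solxh /=.
have sgen1k : <<[set 1; k]>> \subset <[k]>.
  by rewrite gen_subG subUset !sub1set group1 cycle_id.
exact: solvableS sgen1k (abelian_sol (cycle_abelian k)).
Qed.

Lemma solv_covering_dprod_proj G H K X : H \x K = G -> solv_covering G X ->
  solv_covering H (divgr H K @: X :\: solv_radical H) ||
  solv_covering K (remgr H K @: X :\: solv_radical K).
Proof.
move=> defG /solv_coveringP[sXG covX]; have [_ defHK _ _] := dprodP defG.
have projX x : x \in X -> divgr H K x \in H /\ remgr H K x \in K.
  move/(subsetP sXG); rewrite inE -defHK => /andP[_ HKx].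
  by rewrite mem_divgr // mem_remgr.
(* Stated for an arbitrary map [p] into [L], so that it serves both projections: if the non-radical
   images do not cover [L], some [y] is covered only by radical images. *)
have ncov (L : {group gT}) (p : gT -> gT) :
    (forall x, x \in X -> p x \in L) ->
    ~~ solv_covering L (p @: X :\: solv_radical L) ->
  exists2 y, y \in L & forall x, x \in X -> solvable <<[set p x; y]>> ->
    p x \in solv_radical L.
  move=> Lp ncovL.
  have [/'exists_in_forall_inP[y Ly nsol]|] := boolP [exists y in L,
      [forall x in X, solvable <<[set p x; y]>> ==> (p x \in solv_radical L)]].
    by exists y => // x /nsol/implyP.
  rewrite negb_exists_in => /forall_inP ncovy; case/negP: ncovL.
  apply/solv_coveringP; split.
    apply/subsetP=> _ /setDP[/imsetP[x Xx ->] nRx].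
    by rewrite inE nRx Lp.
  move=> y /ncovy; rewrite negb_forall_in => /exists_inP[x Xx].
  rewrite negb_imply => /andP[solxy nRx]; exists (p x) => //.
  by rewrite inE nRx imset_f.
apply/norP=> -[/ncov[x /projX[]//|h Hh radH] /ncov[x /projX[]//|k Kk radK]].
have [|x Xx] := covX (h * k); first by rewrite -defHK mem_mulg.
have [Hx Kx] := projX x Xx.
rewrite {1}(divgr_eq H K x) (solvable_gen2_dprod defG) //.
case/andP=> /(radH x Xx) RHx /(radK x Xx) RKx.
have := subsetP sXG x Xx; rewrite inE => /andP[/negP[]].
rewrite (divgr_eq H K x).
by apply: (subsetP (solv_radical_dprod_sub defG)); rewrite mem_mulg.
Qed.

Lemma alpha_dprod_le G H K : H \x K = G -> ~~ solvable H -> alpha G <= alpha H.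
Proof.
move=> defG nsolH; have [[X covX <-] _] := alphaP nsolH.
have covG := solv_covering_dprodl defG covX.
by have [_] := alphaP (solv_covering_nsol covG); apply.
Qed.

(** Projecting a minimal covering and discarding radical elements does not increase its size. Each
    alternative records that its factor is nonsolvable, so a solvable factor can be ruled out. *)
Lemma alpha_dprod_ge G H K : H \x K = G -> ~~ solvable G ->
  (~~ solvable H /\ alpha H <= alpha G) \/ (~~ solvable K /\ alpha K <= alpha G).
Proof.
move=> defG nsolG; have [[X covX <-] _] := alphaP nsolG.
have card_proj (p : gT -> gT) (R : {set gT}) : #|p @: X :\: R| <= #|X|.
  exact: leq_trans (subset_leq_card (subsetDl _ _)) (leq_imset_card p X).
have leX (L : {group gT}) (p : gT -> gT) :
    solv_covering L (p @: X :\: solv_radical L) ->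
  ~~ solvable L /\ alpha L <= #|X|.
  move=> covL; have nsolL := solv_covering_nsol covL; split=> //.
  by have [_ minL] := alphaP nsolL; apply: leq_trans (minL _ covL) _.
by case/orP: (solv_covering_dprod_proj defG covX) => /leX; [left | right].
Qed.

End Coverings.

Theorem theorem3p2 (gT : finGroupType) (G H K : {group gT})
    (nsolG : ~~ solvable G) (defG : (H \x K)%g = G) :
  (solvable K -> alpha G = alpha H) /\
  (~~ solvable H -> ~~ solvable K -> alpha G = minn (alpha H) (alpha K)).
Proof.
have defG' : K \x H = G by rewrite dprodC.
split=> [solK | nsolH nsolK].
  (* Since [K] is solvable, the covering must come from [H], which also gives the nonsolvability of
     [H] needed for the other inequality. *)
  have [[nsolH leHG]|[]] := alpha_dprod_ge defG nsolG; last by rewrite solK.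
  by apply/eqP; rewrite eqn_leq leHG (alpha_dprod_le defG).
apply/eqP; rewrite eqn_leq leq_min (alpha_dprod_le defG) //.
rewrite (alpha_dprod_le defG') //= geq_min.
by have [[_ ->]|[_ ->]] := alpha_dprod_ge defG nsolG; rewrite ?orbT.
Qed.
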